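(* Let $K\subset\mathbb{R}^n$ be a body. Then the map $\mathcal{E}\mapsto u_K(\mathcal{E})$, from the set of ellipsoids in $\mathbb{R}^n$ to itself, is continuous with respect to the Hausdorff metric.
   Context: A body in $\mathbb{R}^n$ is a compact convex set $K$ with $K=-K$ and non-empty interior; $\|x\|_K=\inf\{\lambda>0: x\in\lambda K\}$ is the norm with unit ball $K$. An ellipsoid means a centrally-symmetric (centered at the origin), non-degenerate ellipsoid. For an ellipsoid $\mathcal{E}$, $\langle\cdot,\cdot\rangle_{\mathcal{E}}$ is the unique scalar product on $\mathbb{R}^n$ with $\mathcal{E}=\{x:\langle x,x\rangle_{\mathcal{E}}\le 1\}$, and $\mu_{\mathcal{E}}$ is the unique Borel probability measure on $\partial\mathcal{E}$ invariant under all linear isometries of $(\mathbb{R}^n,\langle\cdot,\cdot\rangle_{\mathcal{E}})$. For a body $K$, $M_{\mathcal{E}}(K)=\left(\int_{\partial\mathcal{E}}\|x\|_K^2\,d\mu_{\mathcal{E}}(x)\right)^{1/2}$. For a body $K$ and an ellipsoid $\mathcal{E}$, $u_K(\mathcal{E})$ denotes the unique ellipsoid contained in $K$ at which the infimum $J_K(\mathcal{E})=\inf\{M_{\mathcal{E}}(\mathcal{F}):\mathcal{F}\subset K\text{ an ellipsoid}\}$ is attained (such an ellipsoid exists and is unique). *)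

(* Defs.v *)
From HB Require Import structures.
From mathcomp Require Import all_boot all_order all_algebra sesquilinear.
From mathcomp Require Import all_classical all_reals all_analysis.
Import Order.TTheory GRing.Theory Num.Theory.
Import numFieldNormedType.Exports.

Set Implicit Arguments.
Unset Strict Implicit.
Unset Printing Implicit Defensive.

Local Open Scope classical_set_scope.
Local Open Scope ring_scope.

                                                                             
Definition enorm (R : realType) (n : nat) (x : 'rV[R]_n) : R :=
  Num.sqrt (\sum_(i < n) x ord0 i ^+ 2).

Definition is_body (R : realType) (n : nat) (K : set 'rV[R]_n) : Prop :=
  [/\ compact K, convex_set K, K = [set - x | x in K] & K° !=set0].

Definition gauge_norm (R : realType) (n : nat) (K : set 'rV[R]_n)
    (x : 'rV[R]_n) : R :=
  inf [set l : R | 0 < l /\ [set l *: y | y in K] x].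

Definition is_ellipsoid (R : realType) (n : nat) (E : set 'rV[R]_n) : Prop :=
  exists2 A : 'M[R]_n, A \in unitmx &
    E = [set x *m A | x in [set x : 'rV[R]_n | enorm x <= 1]].

Record ellipsoid (R : realType) (n : nat) : Type := Ellipsoid {
  ellipsoid_set :> set 'rV[R]_n;
  ellipsoidP : is_ellipsoid ellipsoid_set }.

HB.instance Definition _ (R : realType) (n : nat) :=
  gen_eqMixin (ellipsoid R n).
HB.instance Definition _ (R : realType) (n : nat) :=
  gen_choiceMixin (ellipsoid R n).

Definition scalar_product_of (R : realType) (n : nat) (E : ellipsoid R n)
    (f : {dot 'rV[R]_n for idfun}) : Prop :=
  E = [set x | f x x <= 1] :> set 'rV[R]_n.

Definition boundary (T : topologicalType) (A : set T) : set T :=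
  closure A `\` A°.

Notation borel_rV R n := (g_sigma_algebraType (@open 'rV[R]_n)).

                                                                             
                                                                          
                                                                             
                       
Definition is_invariant_measure (R : realType) (n : nat) (E : ellipsoid R n)
    (mu : probability (borel_rV R n) R) : Prop :=
  mu (boundary (E : set 'rV[R]_n)) = 1%E /\
  forall (f : {dot 'rV[R]_n for idfun}) (T : {linear 'rV[R]_n -> 'rV[R]_n}),
    scalar_product_of E f ->
    (forall x y, f (T x) (T y) = f x y) ->
    forall A : set (borel_rV R n), measurable A -> mu (T @^-1` A) = mu A.

Section minimal_ellipsoid.
Variables (R : realType) (n : nat).
Variable mu : ellipsoid R n -> probability (borel_rV R n) R.

Definition M_ (E : ellipsoid R n) (K : set 'rV[R]_n) : R :=
  Num.sqrt (\int[mu E]_(x in boundary (E : set 'rV[R]_n))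
    (gauge_norm K x ^+ 2)).

Definition J_ (K : set 'rV[R]_n) (E : ellipsoid R n) : R :=
  inf [set M_ E F | F in [set F : ellipsoid R n | F `<=` K]].

Definition J_minimizer (K : set 'rV[R]_n) (E F : ellipsoid R n) : Prop :=
  F `<=` K /\ M_ E F = J_ K E.

                                                                              
                                                          
Definition u_ (K : set 'rV[R]_n) (E : ellipsoid R n) : ellipsoid R n :=
  xget E [set F | J_minimizer K E F].

End minimal_ellipsoid.

Definition dist_to_set (R : realType) (n : nat) (x : 'rV[R]_n)
    (A : set 'rV[R]_n) : R :=
  inf [set enorm (x - y) | y in A].

                                                                             
Definition hausdorff_dist (R : realType) (n : nat) (A B : set 'rV[R]_n) : R :=
  Num.max (sup [set dist_to_set x B | x in A])
          (sup [set dist_to_set y A | y in B]).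

Definition hausdorff_continuous (R : realType) (n : nat)
    (u : ellipsoid R n -> ellipsoid R n) : Prop :=
  forall (E : ellipsoid R n) (eps : R), 0 < eps ->
  exists2 delta : R, 0 < delta &
    forall E' : ellipsoid R n,
      hausdorff_dist E E' < delta -> hausdorff_dist (u E) (u E') < eps.

(* Main.v *)
Require Import Defs.
From HB Require Import structures.
From mathcomp Require Import all_boot all_order all_algebra sesquilinear.
From mathcomp Require Import ring lra.
From mathcomp Require Import all_classical all_reals all_analysis.
From mathcomp Require Import measurable_realfun.
Import Order.TTheory GRing.Theory Num.Theory.
Import numFieldNormedType.Exports.

Set Implicit Arguments.
Unset Strict Implicit.
Unset Printing Implicit Defensive.

Local Open Scope classical_set_scope.
Local Open Scope ring_scope.

(* An ellipsoid is {x | x P x^T <= 1} for a positive definite P. If E and F have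
   forms Q and P, the invariance of mu_E under signed permutations of an
   orthonormal basis determines its second moments, so that
   M_E(F)^2 = tr(Q^-1 P) / n.

   Put W = Q^-1. Minimizing tr(W P) over the forms of the ellipsoids contained in
   K is a problem with a closed feasible set and compact sublevel sets, hence a
   minimizer exists. It is unique: the harmonic mean of two feasible forms is
   feasible, because K is convex, and P |-> P^-1 being strictly convex it strictly
   decreases the average of the objective.

   If W' is close to W, in the sense that each of the two quadratic forms is at
   most 1 + t times the other, the objectives are also within a factor 1 + t, and
   a compactness argument puts the minimizer for W' close to that for W. Finally
   x W x^T is the square of the support function of E, which is controlled by the
   Hausdorff distance, and closeness of forms gives back Hausdorff closeness. *)

(** * Quadratic forms *)

Section bilinear_forms.
Variables (R : realType).

Definition bform n (P : 'M[R]_n) (x y : 'rV[R]_n) : R :=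
  (x *m P *m y^T) ord0 ord0.

Definition qform n (P : 'M[R]_n) (x : 'rV[R]_n) : R := bform P x x.

Definition posdef n (P : 'M[R]_n) : Prop :=
  P^T = P /\ forall x, x != 0 -> 0 < qform P x.

Section fixed_dimension.
Variable n : nat.
Implicit Types (P Q W G : 'M[R]_n) (x y z : 'rV[R]_n) (a : R).

Lemma bformDl P x y z : bform P (x + y) z = bform P x z + bform P y z.
Proof. by rewrite /bform !mulmxDl mxE. Qed.

Lemma bformDr P x y z : bform P x (y + z) = bform P x y + bform P x z.
Proof. by rewrite /bform linearD mulmxDr mxE. Qed.

Lemma bformZl P a x y : bform P (a *: x) y = a * bform P x y.
Proof. by rewrite /bform -!scalemxAl mxE. Qed.

Lemma bformZr P a x y : bform P x (a *: y) = a * bform P x y.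
Proof. by rewrite /bform linearZ -!scalemxAr mxE. Qed.

Lemma bformNl P x y : bform P (- x) y = - bform P x y.
Proof. by rewrite /bform !mulNmx mxE. Qed.

Lemma bformNr P x y : bform P x (- y) = - bform P x y.
Proof. by rewrite /bform linearN mulmxN mxE. Qed.

Lemma bform_addmx P Q x y : bform (P + Q) x y = bform P x y + bform Q x y.
Proof. by rewrite /bform mulmxDr mulmxDl mxE. Qed.

Lemma bform_scalemx a P x y : bform (a *: P) x y = a * bform P x y.
Proof. by rewrite /bform -scalemxAr -scalemxAl mxE. Qed.

Lemma bform_mull P Q x y : bform P (x *m Q) y = bform (Q *m P) x y.
Proof. by rewrite /bform !mulmxA. Qed.

Lemma bform_mulr P Q x y : bform P x (y *m Q) = bform (P *m Q^T) x y.
Proof. by rewrite /bform trmx_mul !mulmxA. Qed.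

Lemma bform_trmx P x y : bform P^T x y = bform P y x.
Proof.
rewrite /bform -[RHS](mxE trmx_key (fun i j => (y *m P *m x^T) j i)).
by rewrite -/(trmx _) !trmx_mul trmxK mulmxA.
Qed.

Lemma bformE P x y :
  bform P x y = \sum_i \sum_j P i j * (x ord0 i * y ord0 j).
Proof.
rewrite /bform mxE exchange_big; apply: eq_bigr => j _; rewrite !mxE mulr_suml.
by apply: eq_bigr => i _; ring.
Qed.

Lemma qform0 P : qform P 0 = 0.
Proof. by rewrite /qform /bform mul0mx mul0mx mxE. Qed.

Lemma qformZ P a x : qform P (a *: x) = a ^+ 2 * qform P x.
Proof. by rewrite /qform bformZl bformZr mulrA. Qed.

Lemma qformN P x : qform P (- x) = qform P x.
Proof. by rewrite /qform bformNl bformNr opprK. Qed.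

Lemma qform_mul P Q x : qform P (x *m Q) = qform (Q *m P *m Q^T) x.
Proof. by rewrite /qform bform_mull bform_mulr. Qed.

Lemma qformD P x y : P^T = P ->
  qform P (x + y) = qform P x + 2 * bform P x y + qform P y.
Proof.
move=> sP; rewrite /qform bformDl !bformDr.
have -> : bform P y x = bform P x y by rewrite -{1}sP bform_trmx.
ring.
Qed.

Lemma qformB P x y : P^T = P ->
  qform P (x - y) = qform P x - 2 * bform P x y + qform P y.
Proof. by move=> sP; rewrite qformD// bformNr qformN; ring. Qed.

Lemma qform1E x : qform 1%:M x = \sum_i x ord0 i ^+ 2.
Proof.
rewrite /qform /bform mulmx1 mxE; apply: eq_bigr => i _.
by rewrite mxE expr2.
Qed.

Lemma enormE x : enorm x = Num.sqrt (qform 1%:M x).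
Proof. by rewrite qform1E. Qed.

Lemma qform1_ge0 x : 0 <= qform 1%:M x.
Proof. by rewrite qform1E sumr_ge0// => i _; exact: sqr_ge0. Qed.

Lemma qform1_eq0 x : (qform 1%:M x == 0) = (x == 0).
Proof.
apply/eqP/eqP => [|->]; last exact: qform0.
rewrite qform1E => /eqP; rewrite psumr_eq0; last by move=> i _; exact: sqr_ge0.
move=> /allP x0; apply/rowP => i; rewrite mxE; apply/eqP.
by rewrite -sqrf_eq0; apply: x0; rewrite mem_index_enum.
Qed.

Lemma posdef1 : posdef (1%:M : 'M[R]_n).
Proof.
split=> [|x x0]; first exact: trmx1.
by rewrite lt_neqAle eq_sym qform1_eq0 x0 qform1_ge0.
Qed.

Lemma posdef_sym P : posdef P -> P^T = P. Proof. by case. Qed.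

Lemma posdef_ge0 P x : posdef P -> 0 <= qform P x.
Proof.
move=> [_ pP]; have [->|/pP/ltW//] := eqVneq x 0.
by rewrite qform0.
Qed.

Lemma posdef_eq0 P x : posdef P -> qform P x = 0 -> x = 0.
Proof.
move=> [_ pP] Px; apply/eqP/negPn/negP => /pP.
by rewrite Px ltxx.
Qed.

Lemma unitmx_inj (X : 'M[R]_n) :
  (forall x : 'rV_n, x *m X = 0 -> x = 0) -> X \in unitmx.
Proof.
move=> X0; rewrite -row_free_unit -kermx_eq0.
by apply/rowV0P => v /sub_kermxP; exact: X0.
Qed.

Lemma posdef_unit P : posdef P -> P \in unitmx.
Proof.
move=> pP; apply: unitmx_inj => x xP; apply: (posdef_eq0 pP).
by rewrite /qform /bform xP mul0mx mxE.
Qed.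

Lemma qform_mulVmx P x : posdef P -> qform P (x *m invmx P) = qform (invmx P) x.
Proof.
move=> pP; rewrite qform_mul trmx_inv (posdef_sym pP).
by rewrite mulVmx ?mul1mx// posdef_unit.
Qed.

Lemma posdef_inv P : posdef P -> posdef (invmx P).
Proof.
move=> pP; split=> [|x x0]; first by rewrite trmx_inv (posdef_sym pP).
rewrite -qform_mulVmx//; apply: pP.2.
apply: contra_neq x0 => xP0.
by rewrite -(mulmxKV (posdef_unit pP) x) xP0 mul0mx.
Qed.

Lemma posdefD P Q : posdef P -> posdef Q -> posdef (P + Q).
Proof.
move=> [sP pP] [sQ pQ]; split=> [|x x0]; first by rewrite linearD /= sP sQ.
by rewrite /qform bform_addmx addr_gt0// ?pP ?pQ.
Qed.

Lemma posdefZ a P : 0 < a -> posdef P -> posdef (a *: P).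
Proof.
move=> a0 [sP pP]; split=> [|x x0]; first by rewrite linearZ /= sP.
by rewrite /qform bform_scalemx mulr_gt0// pP.
Qed.

Lemma gram_posdef (X : 'M[R]_n) : X \in unitmx -> posdef (X *m X^T).
Proof.
move=> uX; split=> [|x x0]; first by rewrite trmx_mul trmxK.
rewrite -[X *m X^T]mulmx1 -mulmxA -[X^T]mul1mx mulmx1 mulmxA -qform_mul.
apply: posdef1.2; apply: contra_neq x0 => xX.
by rewrite -(mulmxK uX x) xX mul0mx.
Qed.

(** Cauchy-Schwarz: the form is nonnegative at [qform P y *: x - bform P x y *: y], where it equals
    [qform P y] times the wanted difference. *)
Lemma bform_sqr_le P x y : posdef P ->
  bform P x y ^+ 2 <= qform P x * qform P y.
Proof.
move=> pP; have [->|y0] := eqVneq y 0.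
  by rewrite qform0 mulr0 /bform trmx0 mulmx0 mxE expr0n.
have qy := pP.2 _ y0.
have := posdef_ge0 (qform P y *: x - bform P x y *: y) pP.
rewrite qformB ?(posdef_sym pP)// !qformZ bformZl bformZr => h.
rewrite -subr_ge0 -(pmulr_rge0 _ qy).
suff -> : qform P y * (qform P x * qform P y - bform P x y ^+ 2) =
    qform P y ^+ 2 * qform P x - 2 * (qform P y * (bform P x y * bform P x y)) +
    bform P x y ^+ 2 * qform P y by [].
ring.
Qed.

End fixed_dimension.

(** Induction on the size: split off the first coordinate and factor the Schur complement
    [D - t *: (b^T *m b)]. Invertibility of the factor is automatic, since [x *m X = 0] makes the
    form vanish at [x]. *)
Lemma cholesky n (P : 'M[R]_n) : posdef P ->
  exists2 X : 'M[R]_n, X \in unitmx & P = X *m X^T.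
Proof.
suff chol : posdef P -> exists X : 'M[R]_n, P = X *m X^T.
  move=> pP; have [X PX] := chol pP; exists X => //.
  apply: unitmx_inj => x xX; apply: (posdef_eq0 pP).
  by rewrite PX /qform /bform mulmxA xX !mul0mx mxE.
elim: n P => [|n IH] P; first by exists 0; apply/matrixP => -[].
rewrite -[n.+1]/(1 + n)%N in P *.
rewrite -(submxK P); set a := ulsubmx P; set b := ursubmx P.
set c := dlsubmx P; set D := drsubmx P => -[sP pP].
have [ca sD] : c = b^T /\ D^T = D.
  move: sP; rewrite tr_block_mx => /eq_block_mx[_ _ cb sD].
  by split => //; rewrite -cb.
have a0 : 0 < a ord0 ord0.
  have := pP (row_mx 1%:M 0); rewrite /qform /bform mul_row_block.
  rewrite !mul1mx !mul0mx !addr0 tr_row_mx mul_row_col trmx1 mulmx1 trmx0.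
  rewrite mulmx0 addr0; apply; rewrite -row_mx0.
  by apply/eqP => /eq_row_mx[/matrixP/(_ 0 0)/eqP]; rewrite !mxE oner_eq0.
pose s := Num.sqrt (a ord0 ord0).
have s0 : 0 < s by rewrite sqrtr_gt0.
have ss : s * s = a ord0 ord0 by rewrite -expr2 sqr_sqrtr// ltW.
have aE : a = (s * s)%:M by rewrite ss; apply/matrixP => i j; rewrite !ord1 !mxE eqxx.
pose t := (s * s)^-1.
have st : s * s * t = 1 by rewrite mulfV// mulf_neq0// gt_eqF.
have pS : posdef (D - t *: (b^T *m b)).
  split; first by rewrite linearB linearZ /= trmx_mul trmxK sD.
  move=> v v0.
  (* This first coordinate cancels the first block of [row_mx u v *m P], so that the form at
     [row_mx u v] is the Schur complement at [v]. *)
  pose u : 'rV[R]_1 := - (t *: (v *m b^T)).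
  have := pP (row_mx u v); rewrite /qform /bform mul_row_block.
  rewrite tr_row_mx mul_row_col.
  have -> : u *m a + v *m c = 0.
    rewrite aE mul_mx_scalar ca /u scalerN scalerA st scale1r addNr //.
  rewrite mul0mx add0r /u mulNmx -scalemxAl addrC mulmxBr -scalemxAr !mulmxA.
  by apply; apply: contra_neq v0; rewrite -row_mx0 => /eq_row_mx[].
have [Y YE] := IH _ pS.
exists (block_mx s%:M 0 (s^-1 *: b^T) Y).
rewrite tr_block_mx mulmx_block !trmx0 !mul0mx !mulmx0 !addr0 -YE.
rewrite tr_scalar_mx -scalar_mxM -aE; congr block_mx.
- by rewrite linearZ /= trmxK mul_scalar_mx scalerA divff ?scale1r// gt_eqF.
- by rewrite mul_mx_scalar scalerA divff ?scale1r// gt_eqF.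
- rewrite linearZ /= trmxK -scalemxAl -scalemxAr scalerA -invfM addrC.
  by rewrite subrK.
Qed.

End bilinear_forms.

(** * Trace estimates and compact sets of matrices *)

Section form_estimates.
Variables (R : realType) (n : nat).
Implicit Types (P Q W A B : 'M[R]_n) (x y : 'rV[R]_n).

Lemma bform_row A W i j :
  bform W (row i A) (row j A) = (A *m W *m A^T) i j.
Proof.
rewrite /bform !mxE; apply: eq_bigr => k _; rewrite !mxE; congr (_ * _).
by apply: eq_bigr => l _; rewrite !mxE.
Qed.

Lemma mxtrace_qform A W : \tr (A *m W *m A^T) = \sum_i qform W (row i A).
Proof. by apply: eq_bigr => i _; rewrite /qform bform_row. Qed.

(** With [P = Y *m Y^T], both traces become sums of values of the forms at the rows of [Y^T]. *)
Lemma mxtrace_le c A B P :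
    (forall x, qform A x <= c * qform B x) -> posdef P ->
  \tr (A *m P) <= c * \tr (B *m P).
Proof.
move=> AB /cholesky[Y _ ->].
rewrite !mulmxA ![\tr (_ *m Y *m _)]mxtrace_mulC !mulmxA.
rewrite -{2 4}(trmxK Y) !mxtrace_qform mulr_sumr.
by apply: ler_sum => i _; exact: AB.
Qed.

Lemma qform0mx x : qform (0 : 'M[R]_n) x = 0.
Proof. by rewrite /qform /bform mulmx0 mul0mx mxE. Qed.

Lemma mxtrace_posdef_ge0 A P : posdef A -> posdef P -> 0 <= \tr (A *m P).
Proof.
move=> pA pP; have := @mxtrace_le 1 0 A P; rewrite mul0mx mxtrace0 mul1r.
by apply => // x; rewrite mul1r qform0mx posdef_ge0.
Qed.

(** The [i]-th coordinate of [x] is [bform W x (e_i *m invmx W)], so Cauchy-Schwarz bounds its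
    square. Summing over [i] gives the constant [d], the trace of [invmx W]; adding 1 makes it
    strictly positive in every dimension. *)
Lemma posdef_coercive W : posdef W ->
  exists2 c : R, 0 < c & forall x, qform 1%:M x <= c * qform W x.
Proof.
move=> pW; pose d := \sum_i qform (invmx W) (row i 1%:M).
have d0 : 0 <= d.
  by apply: sumr_ge0 => i _; apply: posdef_ge0; exact: posdef_inv.
exists (d + 1); first by rewrite ltr_wpDl.
move=> x; apply: (@le_trans _ _ (d * qform W x)); last first.
  by rewrite ler_wpM2r ?posdef_ge0// lerDl.
rewrite qform1E mulr_suml; apply: ler_sum => i _.
have -> : x ord0 i = bform W x (row i 1%:M *m invmx W).
  rewrite bform_mulr trmx_inv (posdef_sym pW) mulmxV ?posdef_unit//.
  rewrite /bform mulmx1 mxE (bigD1 i)//= !mxE eqxx mulr1 big1 ?addr0// => j ji.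
  by rewrite !mxE eq_sym (negbTE ji) mulr0.
by rewrite mulrC -qform_mulVmx// bform_sqr_le.
Qed.

Lemma coord_sqr_le x i : x ord0 i ^+ 2 <= qform 1%:M x.
Proof.
rewrite qform1E (bigD1 i)//= lerDl sumr_ge0// => j _; exact: sqr_ge0.
Qed.

Lemma coord_mul_le x i j : `|x ord0 i * x ord0 j| <= qform 1%:M x.
Proof.
have := coord_sqr_le x i; have := coord_sqr_le x j.
have := sqr_ge0 (x ord0 i - x ord0 j); have := sqr_ge0 (x ord0 i + x ord0 j).
by rewrite ler_norml => *; apply/andP; split; nra.
Qed.

Lemma qform_norm_le A x e : (forall i j, `|A i j| <= e) ->
  `|qform A x| <= n%:R * n%:R * e * qform 1%:M x.
Proof.
move=> Ae; rewrite /qform bformE.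
apply: (le_trans (ler_norm_sum _ _ _)).
apply: (@le_trans _ _ (\sum_(i < n) (n%:R * (e * qform 1%:M x)))); last first.
  by rewrite sumr_const card_ord -[(_ * _) *+ n]mulr_natl !mulrA.
apply: ler_sum => i _; apply: (le_trans (ler_norm_sum _ _ _)).
rewrite mulr_natl -[X in _ *+ X](card_ord n) -sumr_const.
apply: ler_sum => j _; rewrite normrM ler_pM//.
exact: coord_mul_le.
Qed.

(** Nonnegativity at [e_i + e_j] and [e_i - e_j] bounds twice the entry by the sum of two diagonal
    entries, each at most the trace. *)
Lemma posdef_entry_le P i j : posdef P -> `|P i j| <= \tr P.
Proof.
move=> pP; have PE k l : P k l = bform P (row k 1%:M) (row l 1%:M).
  by rewrite bform_row mul1mx trmx1 mulmx1.
have diag k : 0 <= P k k by rewrite PE; exact: posdef_ge0.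
have trE k : P k k <= \tr P.
  by rewrite /mxtrace (bigD1 k)//= lerDl sumr_ge0.
have := posdef_ge0 (row i 1%:M - row j 1%:M) pP.
have := posdef_ge0 (row i 1%:M + row j 1%:M) pP.
rewrite qformB ?qformD ?(posdef_sym pP)//.
rewrite /qform -!PE => h1 h2; have := trE i; have := trE j.
by rewrite ler_norml => *; apply/andP; split; lra.
Qed.

End form_estimates.

(** * Continuity of matrix expressions and a compactness criterion *)

Section matrix_continuity.
Variable R : realType.

Lemma continuous_sum (T : topologicalType) (I : finType) (F : I -> T -> R) :
  (forall i, continuous (F i)) -> continuous (fun t => \sum_i F i t).
Proof.
move=> cF; apply: continuous_big => [|i _]; last exact: cF.
exact: (@add_continuous R^o).
Qed.

Lemma continuous_mul (T : topologicalType) (f g : T -> R) :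
  continuous f -> continuous g -> continuous (fun t => f t * g t).
Proof. by move=> cf cg t; apply: cvgM; [exact: cf|exact: cg]. Qed.

Lemma continuous_sub (T : topologicalType) (f g : T -> R) :
  continuous f -> continuous g -> continuous (fun t => f t - g t).
Proof. by move=> cf cg t; apply: cvgB; [exact: cf|exact: cg]. Qed.

Lemma continuous_mx (T : topologicalType) m n (F : T -> 'M[R]_(m, n)) :
  (forall i j, continuous (fun t => F t i j)) -> continuous F.
Proof.
move=> cF t A [P /= PF PA].
have : \forall s \near t, forall i j, P i j (F s i j).
  by apply: filter_forall => i; apply: filter_forall => j; exact/cF/PF.
by apply: filterS => s Ps; exact: PA.
Qed.

Lemma continuous_mxentry (m n : nat) i j :
  continuous (fun M : 'M[R]_(m, n) => M i j).
Proof. exact: coord_continuous. Qed.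

Lemma continuous_mulmxr m n (A : 'M[R]_n) :
  continuous (fun x : 'M[R]_(m, n) => x *m A).
Proof.
apply: continuous_mx => i j; under eq_fun do rewrite mxE.
apply: continuous_sum => k.
apply: continuous_mul; [exact: continuous_mxentry|exact: cst_continuous].
Qed.

(** Heine-Borel for matrices: a compact box of row vectors is carried over by the continuous map
    [vec_mx]. *)
Lemma compact_mx m n (A : set 'M[R]_(m, n)) (c : R) : closed A ->
  (forall M, A M -> forall i j, `|M i j| <= c) -> compact A.
Proof.
move=> clA bA.
pose B := [set v : 'rV[R]_(m * n) | forall i, `[- c, c]%classic (v ord0 i)].
have cB : compact B by apply: (@rV_compact _ _ (fun=> `[- c, c]%classic)) => i; exact: segment_compact.
have cv : continuous (vec_mx : 'rV[R]_(m * n) -> 'M[R]_(m, n)).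
  apply: continuous_mx => i j.
  rewrite (_ : (fun _ => _) = fun v : 'rV[R]_(m * n) => v ord0 (mxvec_index i j)).
    exact: continuous_mxentry.
  by apply/funext => v; rewrite mxE.
apply: (subclosed_compact clA (B := vec_mx @` B)).
  by apply: continuous_compact => //; exact: continuous_subspaceT.
move=> M AM; exists (mxvec M); last exact: mxvecK.
move=> k; case/mxvec_indexP: k => i j; rewrite mxvecE /= in_itv /= -ler_norml.
exact: bA.
Qed.

Lemma continuous_qform_mx n (x : 'rV[R]_n) :
  continuous (fun P : 'M[R]_n => qform P x).
Proof.
rewrite /qform; under eq_fun do rewrite bformE.
do 2 (apply: continuous_sum => ?).
apply: continuous_mul; [exact: continuous_mxentry|exact: cst_continuous].
Qed.

Lemma continuous_qform n (P : 'M[R]_n) : continuous (qform P).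
Proof.
rewrite [qform P](_ : _ = fun x => bform P x x)//.
under eq_fun do rewrite bformE.
do 2 (apply: continuous_sum => ?).
apply: continuous_mul; first exact: cst_continuous.
by apply: continuous_mul; exact: continuous_mxentry.
Qed.

Lemma continuous_mxtrace_mul n (W : 'M[R]_n) :
  continuous (fun P : 'M[R]_n => \tr (W *m P)).
Proof.
apply: continuous_sum => i; under eq_fun do rewrite mxE.
apply: continuous_sum => j.
apply: continuous_mul; [exact: cst_continuous|exact: continuous_mxentry].
Qed.

Lemma mx_norm_entry_le m n (M : 'M[R]_(m, n)) i j : `|M i j| <= `|M|.
Proof.
rewrite [leRHS]/Num.norm /= mx_normrE.
by apply/bigmax_geP; right => /=; exists (i, j).
Qed.

End matrix_continuity.

(** * Forms of ellipsoids inscribed in a body *)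

Section inscribed_forms.
Variables (R : realType) (n : nat).
Implicit Types (P Q W A B G : 'M[R]_n) (x y z : 'rV[R]_n) (K : set 'rV[R]_n).

Lemma convex_setE K y z (l : R) : convex_set K -> 0 <= l -> l <= 1 ->
  K y -> K z -> K (l *: y + (1 - l) *: z).
Proof.
move=> cK l0 l1 Ky Kz.
by have := cK y z (Itv01 l0 l1) (mem_set Ky) (mem_set Kz); rewrite inE.
Qed.

Lemma body_closed K : is_body K -> closed K.
Proof. by case=> + _ _ _; apply: compact_closed; exact: norm_hausdorff. Qed.

Lemma body_ball K : is_body K -> exists2 e : R, 0 < e &
  forall x, `|x| < e -> K x.
Proof.
move=> [_ cK sK [x0]]; rewrite /interior /= -nbhs_ballE => -[e /= e0 xK].
exists e => // y ye.
(* By symmetry and convexity, the ball around the interior point [x0] can be moved to the origin: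
   [y] is the midpoint of two points of [K]. *)
have -> : y = 2^-1 *: (x0 + y) + (1 - 2^-1) *: (- (x0 - y)).
  have -> : 1 - 2^-1 = 2^-1 :> R by lra.
  rewrite -scalerDr opprB addrC addrA subrK -mulr2n -[y *+ 2]scaler_nat scalerA.
  by rewrite mulVf ?scale1r.
apply: convex_setE => //.
- by lra.
- by apply: xK; rewrite -ball_normE /= opprD addrA subrr add0r normrN.
- rewrite sK; exists (x0 - y) => //; apply: xK.
  by rewrite -ball_normE /= opprB addrC subrK.
Qed.

Lemma body0 K : is_body K -> K 0.
Proof. by move=> /body_ball[e e0]; apply; rewrite normr0. Qed.

Lemma body_bounded K : is_body K -> exists2 r : R, 0 < r &
  forall x, K x -> qform 1%:M x < r.
Proof.
move=> bK; have [cK _ _ _] := bK.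
have K0 : K !=set0 by exists 0; exact: body0.
have [//|c _ cP] := compact_EVT_max K0 cK (f := qform (1%:M : 'M[R]_n)).
  by apply: continuous_subspaceT; exact: continuous_qform.
exists (qform 1%:M c + 1); first by rewrite ltr_wpDl ?qform1_ge0.
by move=> x Kx; rewrite (le_lt_trans (cP x (mem_set Kx)))// ltrDl.
Qed.

(* For positive definite P this says that the ellipsoid {qform P <= 1} lies in
   K; it is closed and convex in P, and forces P to be positive definite. *)
Definition inscribed K : set 'M[R]_n :=
  [set P | P^T = P /\ forall x, ~ K x -> 1 <= qform P x].

(** A nonzero [x] rescaled to squared length [r] leaves [K], so the form is at least 1 there. The
    constant depends on [K] alone, which later makes the estimates uniform over all inscribed
    forms. *)
Lemma inscribed_coercive K : is_body K -> exists2 r : R, 0 < r &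
  forall P, inscribed K P -> forall x, qform 1%:M x <= r * qform P x.
Proof.
move=> /body_bounded[r r0 Kr]; exists r => // P [_ PK] x.
have [->|x0] := eqVneq x 0; first by rewrite !qform0 mulr0.
have qx : 0 < qform 1%:M x by rewrite (posdef1 R n).2.
have s2 : (Num.sqrt (r / qform 1%:M x)) ^+ 2 = r / qform 1%:M x.
  by rewrite sqr_sqrtr// divr_ge0// ltW.
have /PK : ~ K (Num.sqrt (r / qform 1%:M x) *: x).
  by move=> /Kr; rewrite qformZ s2 divfK ?ltxx// gt_eqF.
by rewrite qformZ s2 mulrAC ler_pdivlMr// mul1r.
Qed.

Lemma inscribed_posdef K P : is_body K -> inscribed K P -> posdef P.
Proof.
move=> /inscribed_coercive[r r0 KP] iP; split=> [|x x0]; first by case: iP.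
rewrite -(pmulr_rgt0 _ r0); apply: lt_le_trans (KP _ iP x).
by rewrite (posdef1 R n).2.
Qed.

Lemma inscribed_closed K : closed (inscribed K).
Proof.
rewrite (_ : inscribed K =
  (\bigcap_(i in [set: 'I_n]) \bigcap_(j in [set: 'I_n])
     [set P : 'M[R]_n | P j i - P i j = 0]) `&`
  \bigcap_(x in ~` K) [set P | 1 <= qform P x]).
  apply: closedI.
    apply: closed_bigI => i _; apply: closed_bigI => j _.
    have cf : continuous (fun P : 'M[R]_n => P j i - P i j).
      by apply: continuous_sub; exact: continuous_mxentry.
    exact: ((continuous_closedP _).1 cf [set t | t = 0] (@closed_eq R 0)).
  apply: closed_bigI => x _.
  exact: ((continuous_closedP _).1 (@continuous_qform_mx R n x) [set t | 1 <= t] (@closed_ge R 1)).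
apply/seteqP; split=> P /=.
  move=> [sP KP]; split=> [i _ j _ /=|x /KP//].
  by rewrite -{1}sP mxE subrr.
move=> [sP KP]; split=> [|x Kx]; last exact: KP.
by apply/matrixP => i j; rewrite mxE; apply/eqP; rewrite -subr_eq0 sP.
Qed.

Lemma inscribed_nonempty K : is_body K -> inscribed K !=set0.
Proof.
(* The form of the Euclidean ball of radius [e]; it works because the Euclidean norm dominates the
   maximum norm in which [body_ball] is stated. *)
move=> /body_ball[e e0 eK]; exists (e ^- 2 *: 1%:M).
split=> [|x Kx]; first by rewrite linearZ /= trmx1.
rewrite /qform bform_scalemx mulrC ler_pdivlMr ?exprn_gt0// mul1r.
have xe : e <= `|x| by rewrite leNgt; apply/negP => /eK.
have x0 : `|x| != 0 by rewrite gt_eqF// (lt_le_trans e0).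
have [[k i] /= xi] := mx_norm_neq0 x0; rewrite ord1 in xi.
apply: le_trans (coord_sqr_le x i).
rewrite -[leRHS]real_normK ?num_real// lerXn2r ?nnegrE ?(ltW e0)//.
by rewrite -xi.
Qed.

(* Averaging the inverses of the forms averages the squared support functions
   of the ellipsoids. *)
Definition hmean P Q := invmx (2^-1 *: (invmx P + invmx Q)).

Lemma hmean_inv_posdef P Q : posdef P -> posdef Q ->
  posdef (2^-1 *: (invmx P + invmx Q)).
Proof.
by move=> pP pQ; apply: posdefZ; [lra|apply: posdefD; exact: posdef_inv].
Qed.

Lemma qform_hmean P Q x : posdef P -> posdef Q ->
  2 * qform (hmean P Q) x =
  qform (invmx P) (x *m hmean P Q) + qform (invmx Q) (x *m hmean P Q).
Proof.
move=> pP pQ; have pG := hmean_inv_posdef pP pQ.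
rewrite -[qform (hmean P Q) x]qform_mulVmx// -/(hmean P Q).
rewrite /qform bform_scalemx bform_addmx; lra.
Qed.

Lemma hmean_decomp P Q x : posdef P -> posdef Q ->
  2 *: x = x *m hmean P Q *m invmx P + x *m hmean P Q *m invmx Q.
Proof.
move=> pP pQ; have pG := hmean_inv_posdef pP pQ.
rewrite -[in LHS](mulmxKV (posdef_unit pG) x) -/(hmean P Q) -mulmxDr.
by rewrite -scalemxAr scalerA divff ?scale1r.
Qed.

(** With [z = x *m hmean P Q], the point [x] is the midpoint of [z *m invmx P] and [z *m invmx Q].
    It is rewritten as a convex combination of multiples of these two points; as [x] is outside [K],
    so is one of the multiples, which bounds [((g + h) / 2) ^+ 2] below by 1. The form of the
    harmonic mean at [x] is [(g ^+ 2 + h ^+ 2) / 2], which is at least that square. *)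
Lemma hmean_inscribed K P Q : is_body K ->
  inscribed K P -> inscribed K Q -> inscribed K (hmean P Q).
Proof.
move=> bK iP iQ.
have pP := inscribed_posdef bK iP; have pQ := inscribed_posdef bK iQ.
have pG := hmean_inv_posdef pP pQ.
split=> [|x Kx]; first by apply: posdef_sym; exact: posdef_inv.
have x0 : x != 0 by apply/eqP => x0; apply: Kx; rewrite x0; exact: body0.
set z := x *m hmean P Q.
have z0 : z != 0.
  apply: contra_neq x0 => z0.
  by rewrite -(mulmxKV (posdef_unit pG) x) -/(hmean P Q) -/z z0 mul0mx.
have zx := hmean_decomp x pP pQ; have qx := qform_hmean x pP pQ.
rewrite -/z in zx qx.
set g := Num.sqrt (qform (invmx P) z); set h := Num.sqrt (qform (invmx Q) z).
have g0 : 0 < g by rewrite sqrtr_gt0 (posdef_inv pP).2.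
have h0 : 0 < h by rewrite sqrtr_gt0 (posdef_inv pQ).2.
have g2 : qform (invmx P) z = g ^+ 2.
  by rewrite sqr_sqrtr// ltW// (posdef_inv pP).2.
have h2 : qform (invmx Q) z = h ^+ 2.
  by rewrite sqr_sqrtr// ltW// (posdef_inv pQ).2.
(* The weight [l] and the factors [s], [t] are chosen so that [P] at the first point and [Q] at the
   second both equal [((g + h) / 2) ^+ 2]. *)
pose l := g / (g + h).
have gh0 : g + h != 0 by rewrite gt_eqF// addr_gt0.
pose s := (g + h) / (2 * g); pose t := (g + h) / (2 * h).
have xE : x = l *: (s *: (z *m invmx P)) + (1 - l) *: (t *: (z *m invmx Q)).
  rewrite !scalerA.
  have -> : l * s = 2^-1 by rewrite /l /s; field; rewrite gh0 gt_eqF.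
  have -> : (1 - l) * t = 2^-1 by rewrite /l /t; field; rewrite gh0 gt_eqF.
  by rewrite -scalerDr -zx scalerA mulVf ?scale1r.
have l0 : 0 <= l by rewrite divr_ge0 ?addr_ge0// ltW.
have l1 : l <= 1 by rewrite ler_pdivrMr ?addr_gt0// mul1r lerDl ltW.
have gh : 1 <= ((g + h) / 2) ^+ 2.
  have [K1|/iP.2] := pselect (K (s *: (z *m invmx P))); last first.
    rewrite qformZ qform_mulVmx// g2 -exprMn.
    by rewrite (_ : s * g = (g + h) / 2)// /s; field; rewrite gt_eqF.
  have [K2|/iQ.2] := pselect (K (t *: (z *m invmx Q))); last first.
    rewrite qformZ qform_mulVmx// h2 -exprMn.
    by rewrite (_ : t * h = (g + h) / 2)// /t; field; rewrite gt_eqF.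
  exfalso; apply: Kx; rewrite xE; apply: convex_setE => //.
  by case: bK.
have := sqr_ge0 (g - h); rewrite g2 h2 in qx; nra.
Qed.

(** Strict convexity as an exact identity, obtained by completing squares: the right side is
    nonnegative, and it vanishes only if [x *m P] and [x *m Q] coincide. *)
Lemma qform_hmean_gap P Q x : posdef P -> posdef Q ->
  qform P x + qform Q x - 2 * qform (hmean P Q) x =
  qform (invmx P) (x *m P - x *m hmean P Q) +
  qform (invmx Q) (x *m Q - x *m hmean P Q).
Proof.
move=> pP pQ; set z := x *m hmean P Q.
have gap B : posdef B -> qform (invmx B) (x *m B - z) =
    qform B x - 2 * (x *m z^T) ord0 ord0 + qform (invmx B) z.
  move=> pB; rewrite qformB ?(posdef_sym (posdef_inv pB))//.
  rewrite qform_mul (posdef_sym pB) mulmxV ?posdef_unit// mul1mx.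
  by rewrite bform_mull mulmxV ?posdef_unit// /bform mulmx1.
have xz : (x *m z^T) ord0 ord0 = qform (hmean P Q) x.
  rewrite /z trmx_mul mulmxA.
  by rewrite (posdef_sym (posdef_inv (hmean_inv_posdef pP pQ))).
have := qform_hmean x pP pQ; rewrite !gap// xz -/z; lra.
Qed.

(** Writing [W = X *m X^T], the difference of the two sides is the sum of the gaps at the rows of
    [X^T]. If it is zero, then [X^T *m P = X^T *m Q], and [X^T] is invertible. *)
Lemma mxtrace_hmean_lt W P Q : posdef W -> posdef P -> posdef Q -> P != Q ->
  2 * \tr (W *m hmean P Q) < \tr (W *m P) + \tr (W *m Q).
Proof.
move=> /cholesky[X uX ->] pP pQ PQ.
have trE B : \tr (X *m X^T *m B) = \sum_i qform B (row i X^T).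
  by rewrite -mulmxA mxtrace_mulC -{2}(trmxK X) mxtrace_qform.
rewrite !trE mulr_sumr -big_split /=.
have gap x : 0 <= qform P x + qform Q x - 2 * qform (hmean P Q) x.
  by rewrite qform_hmean_gap// addr_ge0// posdef_ge0//; exact: posdef_inv.
rewrite lt_neqAle ler_sum ?andbT; last first.
  by move=> i _; rewrite -subr_ge0.
apply: contra_neq PQ => /eqP; rewrite eq_sym -subr_eq0 -sumrB psumr_eq0//.
move=> /allP e0.
have {}e0 i : row i X^T *m P = row i X^T *m Q.
  have /= := e0 i (mem_index_enum i); rewrite qform_hmean_gap//.
  rewrite paddr_eq0 ?posdef_ge0//; try exact: posdef_inv.
  move=> /andP[/eqP/(posdef_eq0 (posdef_inv pP))/eqP].
  rewrite subr_eq0 => /eqP ->.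
  move=> /eqP/(posdef_eq0 (posdef_inv pQ))/eqP.
  by rewrite subr_eq0 => /eqP ->.
have XPQ : X^T *m P = X^T *m Q by apply/row_matrixP => i; rewrite !row_mul.
have uXT : X^T \in unitmx by rewrite unitmx_tr.
by rewrite -(mulKmx uXT P) XPQ mulKmx.
Qed.

End inscribed_forms.

(** * Minimizers and the Hausdorff distance *)

Section minimizing_forms.
Variables (R : realType) (n : nat) (K : set 'rV[R]_n).
Hypothesis bK : is_body K.
Implicit Types (P Q W : 'M[R]_n).

Definition minimizes W P :=
  inscribed K P /\ forall Q, inscribed K Q -> \tr (W *m P) <= \tr (W *m Q).

(** Coercivity of [W] bounds the trace of [P] by [d * c], and the trace bounds every entry of a
    positive definite matrix. *)
Lemma compact_sublevel W (c : R) : posdef W ->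
  compact (inscribed K `&` [set P | \tr (W *m P) <= c]).
Proof.
move=> pW; have [d d0 dW] := posdef_coercive pW.
apply: (@compact_mx R n n _ (d * c)).
  apply: closedI; first exact: inscribed_closed.
  exact: ((continuous_closedP _).1 (@continuous_mxtrace_mul R n W)
            [set t | t <= c] (@closed_le R c)).
move=> P [iP /= Pc] i j; have pP := inscribed_posdef bK iP.
apply: (le_trans (posdef_entry_le i j pP)).
rewrite -[P in \tr P]mul1mx; apply: (le_trans (mxtrace_le dW pP)).
by rewrite ler_wpM2l// ltW.
Qed.

(** The closed set [A] is the whole space when a minimizer is constructed, and the complement of a
    ball around the minimizer in the stability argument. *)
Lemma exists_min_on W (A : set 'M[R]_n) : posdef W -> closed A ->
  inscribed K `&` A !=set0 ->
  exists P, [/\ inscribed K P, A P &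
    forall Q, inscribed K Q -> A Q -> \tr (W *m P) <= \tr (W *m Q)].
Proof.
move=> pW clA [P0 [iP0 AP0]]; set c := \tr (W *m P0).
pose B := A `&` (inscribed K `&` [set P | \tr (W *m P) <= c]).
have cB : compact B.
  rewrite /B setIC; apply: compact_closedI => //; exact: compact_sublevel.
have B0 : B !=set0 by exists P0; split => //; split => //=.
have [|P PB Pmin] := compact_EVT_min B0 cB (f := fun P => \tr (W *m P)).
  by apply: continuous_subspaceT; exact: continuous_mxtrace_mul.
have [AP [iP Pc]] := set_mem PB.
exists P; split => // Q iQ AQ.
have [Qc|/ltW Qc] := leP (\tr (W *m Q)) c; first exact/Pmin/mem_set.
exact: le_trans Pc Qc.
Qed.

Lemma exists_minimizer W : posdef W -> exists P, minimizes W P.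
Proof.
move=> pW; have [|P [iP _ Pmin]] := exists_min_on pW closedT.
  by rewrite setIT; exact: inscribed_nonempty.
by exists P; split => // Q iQ; exact: Pmin.
Qed.

(** Otherwise the inscribed form [hmean P Q] would have a strictly smaller objective than [P]. *)
Lemma minimizer_unique W P Q : posdef W -> minimizes W P -> inscribed K Q ->
  \tr (W *m Q) <= \tr (W *m P) -> P = Q.
Proof.
move=> pW [iP Pmin] iQ QP; apply/eqP/negPn/negP => PQ.
have := mxtrace_hmean_lt pW (inscribed_posdef bK iP) (inscribed_posdef bK iQ) PQ.
have := Pmin _ (hmean_inscribed bK iP iQ).
by move=> h1 h2; move: (lt_le_trans h2 (lerD (lexx _) QP)); lra.
Qed.

(** Inscribed forms at distance at least [e] from [P] exceed the minimum [m] by a fixed gap [g]. A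
    minimizer for [W'] has [W]-objective at most [(1 + t) ^+ 2 * m], which stays below [m + g]. *)
Lemma minimizer_stable W P (e : R) : posdef W -> minimizes W P -> 0 < e ->
  exists2 t : R, 0 < t & forall W', posdef W' ->
    (forall x, qform W' x <= (1 + t) * qform W x) ->
    (forall x, qform W x <= (1 + t) * qform W' x) ->
    forall P', minimizes W' P' -> `|P' - P| < e.
Proof.
move=> pW mP e0; have [iP Pmin] := mP.
have pP := inscribed_posdef bK iP.
set m := \tr (W *m P).
have m0 : 0 <= m by exact: mxtrace_posdef_ge0.
have [g g0 gP] : exists2 g : R, 0 < g & forall Q, inscribed K Q ->
    e <= `|Q - P| -> m + g <= \tr (W *m Q).
  have clA : closed [set Q : 'M[R]_n | e <= `|Q - P|].
    have cf : continuous (fun Q : 'M[R]_n => `|Q - P|).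
      have cB : continuous (fun Q : 'M[R]_n => Q - P).
        apply: continuous_mx => i j; under eq_fun do rewrite mxE.
        rewrite mxE; apply: continuous_sub; first exact: continuous_mxentry.
        exact: cst_continuous.
      by move=> Q; apply: continuous_comp; [exact: cB|exact: norm_continuous].
    exact: ((continuous_closedP _).1 cf [set t | e <= t] (@closed_ge R e)).
  have [ne|empty] := pselect (inscribed K `&` [set Q | e <= `|Q - P|] !=set0).
    have [Q [iQ /= eQ Qmin]] := exists_min_on pW clA ne.
    exists (\tr (W *m Q) - m) => [|Q' iQ' eQ']; last first.
      by rewrite addrC subrK; exact: Qmin.
    (* The gap is positive by uniqueness: a far form attaining [m] would be [P] itself. *)
    rewrite subr_gt0 ltNge; apply/negP => /(minimizer_unique pW mP iQ) PQ.
    by move: eQ; rewrite PQ subrr normr0 leNgt e0.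
  exists 1 => // Q iQ eQ; exfalso; apply: empty.
  by exists Q.
(* For [t <= 1] the increase of [(1 + t) ^+ 2 * m] over [m] is at most [3 * t * m]. The summand 1
   keeps the denominator positive when [m = 0], and the half makes the bound by [g] strict. *)
pose t := Num.min 1 (g / (3 * m + 1) / 2).
have g1 : 0 < g / (3 * m + 1) / 2 by rewrite !divr_gt0//; lra.
have t0 : 0 < t by rewrite lt_min ltr01.
have t1 : t <= 1 by rewrite ge_min lexx.
have tg : t * (3 * m + 1) < g.
  apply: (@le_lt_trans _ _ (g / (3 * m + 1) / 2 * (3 * m + 1))).
    by rewrite ler_wpM2r ?ge_min ?lexx ?orbT//; lra.
  rewrite mulrAC divfK ?gt_eqF//; last by lra.
  by rewrite ltr_pdivrMr//; lra.
exists t => // W' pW' W'W WW' P' [iP' P'min].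
rewrite ltNge; apply/negP => /(gP _ iP').
have pP' := inscribed_posdef bK iP'.
have h1 := mxtrace_le WW' pP'.
have h2 := mxtrace_le W'W pP.
have h3 := P'min _ iP.
have t10 : 0 <= 1 + t by lra.
have h4 := ler_wpM2l t10 (le_trans h3 h2).
rewrite -/m in h4 => h5.
have := le_trans h5 (le_trans h1 h4).
suff : (1 + t) * ((1 + t) * m) <= m + t * (3 * m + 1) by lra.
have : t * t * m <= t * m by rewrite ler_wpM2r// ler_piMl// ltW.
lra.
Qed.

End minimizing_forms.

(** * Hausdorff distance between unit balls of forms *)

Section hausdorff_distance.
Variables (R : realType) (n : nat).
Implicit Types (P Q W : 'M[R]_n) (x y z : 'rV[R]_n) (A B : set 'rV[R]_n).

Definition unit_ball Q : set 'rV[R]_n := [set x | qform Q x <= 1].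

Lemma enorm_ge0 x : 0 <= enorm x. Proof. exact: sqrtr_ge0. Qed.

Lemma enorm_le1 x : (enorm x <= 1) = (qform 1%:M x <= 1).
Proof. by rewrite enormE -[X in _ <= X]sqrtr1 ler_sqrt. Qed.

Lemma enormZ (a : R) x : enorm (a *: x) = `|a| * enorm x.
Proof. by rewrite !enormE qformZ sqrtrM ?sqr_ge0// sqrtr_sqr. Qed.

Lemma enorm_le_coercive P x (r : R) :
  (forall y, qform 1%:M y <= r * qform P y) ->
  0 <= r -> enorm x <= Num.sqrt r * Num.sqrt (qform P x).
Proof. by move=> rP r0; rewrite enormE -sqrtrM// ler_wsqrtr. Qed.

Lemma bform1_le x y : bform 1%:M x y <= enorm x * enorm y.
Proof.
apply: (le_trans (ler_norm _)).
rewrite !enormE -sqrtrM ?qform1_ge0// -sqrtr_sqr ler_wsqrtr//.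
exact: bform_sqr_le (posdef1 R n).
Qed.

(** The right side is the support function of the ellipsoid in direction [y]; the bound is
    Cauchy-Schwarz for [Q] applied to [x] and [y *m invmx Q]. *)
Lemma support_ub Q x y : posdef Q -> unit_ball Q x ->
  bform 1%:M x y <= Num.sqrt (qform (invmx Q) y).
Proof.
rewrite /unit_ball /= => pQ Qx; apply: (le_trans (ler_norm _)).
rewrite -sqrtr_sqr ler_wsqrtr//.
have -> : bform 1%:M x y = bform Q x (y *m invmx Q).
  by rewrite bform_mulr trmx_inv (posdef_sym pQ) mulmxV// posdef_unit.
apply: (le_trans (bform_sqr_le _ _ pQ)).
by rewrite qform_mulVmx// ler_piMl// posdef_ge0//; exact: posdef_inv.
Qed.

Lemma support_attained Q y : posdef Q ->
  exists2 x, unit_ball Q x & bform 1%:M x y = Num.sqrt (qform (invmx Q) y).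
Proof.
move=> pQ; have [->|y0] := eqVneq y 0.
  exists 0; first by rewrite /unit_ball /= qform0 ler01.
  by rewrite qform0 sqrtr0 -/(qform _ _) qform0.
have W0 := (posdef_inv pQ).2 _ y0.
have s0 : 0 < Num.sqrt (qform (invmx Q) y) by rewrite sqrtr_gt0.
have s2 := sqr_sqrtr (ltW W0).
exists ((Num.sqrt (qform (invmx Q) y))^-1 *: (y *m invmx Q)).
  by rewrite /unit_ball /= qformZ qform_mulVmx// -{2}s2 exprVn mulVf// gt_eqF// exprn_gt0.
rewrite bformZl bform_mull mulmx1 -/(qform _ _) -{2}s2 expr2 mulKf//.
by rewrite gt_eqF.
Qed.

Lemma dist_to_set_le x y B : B y -> dist_to_set x B <= enorm (x - y).
Proof.
move=> By; apply: ge_inf; last by exists y.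
by exists 0 => _ [z _ <-]; exact: enorm_ge0.
Qed.

(** As [B] contains the origin, distances to [B] are at most norms; the bound [M] therefore makes
    the supremum an upper bound of all distances. *)
Lemma sup_dist_lt A B (M d : R) : (forall x, A x -> enorm x <= M) -> B 0 ->
  sup [set dist_to_set x B | x in A] < d ->
  forall x, A x -> exists2 y, B y & enorm (x - y) < d.
Proof.
move=> AM B0 supd x Ax.
have : dist_to_set x B < d.
  apply: le_lt_trans supd; apply: ub_le_sup; last by exists x.
  exists M => _ [z Az <-]; apply: le_trans (AM _ Az).
  by rewrite -[z in leRHS]subr0 dist_to_set_le.
move=> /inf_lt[|_ [y By <-] xy]; last by exists y.
by exists (enorm (x - 0)); exists 0.
Qed.

Lemma sup_dist_le A B (d : R) : A !=set0 ->
  (forall x, A x -> exists2 y, B y & enorm (x - y) <= d) ->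
  sup [set dist_to_set x B | x in A] <= d.
Proof.
move=> [x0 Ax0] ABd; apply: ge_sup; first by exists (dist_to_set x0 B); exists x0.
by move=> _ [x /ABd[y By xy] <-]; exact: le_trans (dist_to_set_le x By) xy.
Qed.

Lemma unit_ball0 Q : unit_ball Q 0.
Proof. by rewrite /unit_ball /= qform0 ler01. Qed.

Lemma unit_ball_enorm_le Q (r : R) x : 0 <= r ->
    (forall y, qform 1%:M y <= r * qform Q y) ->
  unit_ball Q x -> enorm x <= Num.sqrt r.
Proof.
move=> r0 rQ Qx; rewrite enormE ler_wsqrtr// (le_trans (rQ x))//.
by rewrite ler_piMr.
Qed.

Lemma hausdorff_dist_lt Q Q' (d : R) : posdef Q -> posdef Q' ->
  hausdorff_dist (unit_ball Q) (unit_ball Q') < d ->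
  (forall x, unit_ball Q x -> exists2 y, unit_ball Q' y & enorm (x - y) < d) /\
  (forall x, unit_ball Q' x -> exists2 y, unit_ball Q y & enorm (x - y) < d).
Proof.
move=> /posdef_coercive[r r0 rQ] /posdef_coercive[s s0 sQ'].
rewrite /hausdorff_dist gt_max => /andP[h1 h2]; split.
- apply: (@sup_dist_lt _ _ (Num.sqrt r)) h1 => [x|]; last exact: unit_ball0.
  by apply: unit_ball_enorm_le rQ; exact: ltW.
- apply: (@sup_dist_lt _ _ (Num.sqrt s)) h2 => [x|]; last exact: unit_ball0.
  by apply: unit_ball_enorm_le sQ'; exact: ltW.
Qed.

(** A point of the second ball attaining its support value is within [d] of a point of the first
    ball, and the inner product with [y] changes by at most [d * enorm y]. *)
Lemma support_perturb Q Q' (d : R) y : posdef Q -> posdef Q' ->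
  (forall x, unit_ball Q' x -> exists2 z, unit_ball Q z & enorm (x - z) < d) ->
  Num.sqrt (qform (invmx Q') y) <= Num.sqrt (qform (invmx Q) y) + d * enorm y.
Proof.
move=> pQ pQ' QQ'; have [x /QQ'[z Qz xz] <-] := support_attained y pQ'.
rewrite -{1}(subrK z x) bformDl addrC lerD ?support_ub//.
by apply: (le_trans (bform1_le _ _)); rewrite ler_wpM2r ?enorm_ge0// ltW.
Qed.

(** Hausdorff closeness gives an additive error between support functions; coercivity of [invmx Q]
    turns it into a relative one. *)
Lemma hausdorff_dist_polar Q (t : R) : posdef Q -> 0 < t ->
  exists2 d : R, 0 < d & forall Q', posdef Q' ->
    hausdorff_dist (unit_ball Q) (unit_ball Q') < d ->
    (forall x, qform (invmx Q') x <= (1 + t) * qform (invmx Q) x) /\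
    (forall x, qform (invmx Q) x <= (1 + t) * qform (invmx Q') x).
Proof.
move=> pQ t0; have [c c0 cQ] := posdef_coercive (posdef_inv pQ).
(* These bounds give [(1 + 2 * s) ^+ 2 <= 1 + 6 * s <= 1 + t]. *)
pose s := Num.min 2^-1 (t / 6).
have s0 : 0 < s by rewrite lt_min; apply/andP; split; lra.
have s1 : s <= 2^-1 by rewrite ge_min lexx.
have st : s <= t / 6 by rewrite ge_min lexx orbT.
have sc0 : 0 < Num.sqrt c by rewrite sqrtr_gt0.
exists (s / Num.sqrt c) => [|Q' pQ' /(hausdorff_dist_lt pQ pQ')[QQ' Q'Q]].
  by rewrite divr_gt0.
have key (a b : R) : 0 <= a -> 0 <= b ->
    Num.sqrt a <= (1 + 2 * s) * Num.sqrt b -> a <= (1 + t) * b.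
  move=> a0 b0 ab; rewrite -(sqr_sqrtr a0) -(sqr_sqrtr b0).
  set u := Num.sqrt a in ab *; set v := Num.sqrt b in ab *.
  have u0 : 0 <= u by exact: sqrtr_ge0.
  have v0 : 0 <= v by exact: sqrtr_ge0.
  apply: (@le_trans _ _ (((1 + 2 * s) * v) ^+ 2)).
    by rewrite lerXn2r ?nnegrE// (le_trans u0).
  by rewrite exprMn ler_wpM2r ?sqr_ge0//; nra.
have dy y : s / Num.sqrt c * enorm y <= s * Num.sqrt (qform (invmx Q) y).
  rewrite -mulrA ler_wpM2l ?(ltW s0)// mulrC ler_pdivrMr// mulrC.
  by apply: enorm_le_coercive => //; exact: ltW.
have pos (B : 'M[R]_n) y : posdef B -> 0 <= qform (invmx B) y.
  by move=> pB; apply: posdef_ge0; exact: posdef_inv.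
split => y; apply: key; try exact: pos.
- have := le_trans (support_perturb y pQ pQ' Q'Q) (lerD (lexx _) (dy y)).
  have := sqrtr_ge0 (qform (invmx Q) y); nra.
(* Here the error is relative to the left side: [(1 - s) * u <= v], and [(1 + 2 * s) * (1 - s) >= 1]
   because [s <= 2^-1]. *)
- have := le_trans (support_perturb y pQ' pQ QQ') (lerD (lexx _) (dy y)).
  have := sqrtr_ge0 (qform (invmx Q) y).
  set u := Num.sqrt (qform (invmx Q) y); set v := Num.sqrt _ => u0 uv.
  have su : 0 <= s * (1 - 2 * s) * u by rewrite !mulr_ge0//; lra.
  have : (1 + 2 * s) * (u - s * u) <= (1 + 2 * s) * v by rewrite ler_wpM2l; lra.
  lra.
Qed.

(** Shrinking [x] by the factor [1 + t] brings it into the other ball and moves it by at most [t]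
    times its norm. *)
Lemma unit_ball_approx P P' (r t : R) x : 0 <= r -> 0 <= t ->
    (forall y, qform 1%:M y <= r * qform P y) ->
    (forall y, qform P' y <= (1 + t) * qform P y) ->
  unit_ball P x ->
  exists2 y, unit_ball P' y & enorm (x - y) <= t * Num.sqrt r.
Proof.
move=> r0 t0 rP PP' Px; have t1 : 0 < 1 + t by lra.
exists ((1 + t)^-1 *: x).
  rewrite /unit_ball /= qformZ exprVn mulrC ler_pdivrMr ?exprn_gt0// mul1r.
  apply: (le_trans (PP' x)); rewrite expr2 ler_wpM2l ?(ltW t1)//.
  by apply: (le_trans Px); rewrite lerDl.
rewrite -[X in X - _]scale1r -scalerBl enormZ.
have -> : 1 - (1 + t)^-1 = t / (1 + t) by field; rewrite gt_eqF.
rewrite ger0_norm ?divr_ge0 ?(ltW t1)// ler_pM ?divr_ge0 ?enorm_ge0 ?(ltW t1)//.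
  by rewrite ler_pdivrMr// ler_peMr// lerDl.
exact: unit_ball_enorm_le rP Px.
Qed.

Lemma hausdorff_dist_le P P' (r t : R) : 0 <= r -> 0 <= t ->
    (forall y, qform 1%:M y <= r * qform P y) ->
    (forall y, qform 1%:M y <= r * qform P' y) ->
    (forall y, qform P' y <= (1 + t) * qform P y) ->
    (forall y, qform P y <= (1 + t) * qform P' y) ->
  hausdorff_dist (unit_ball P) (unit_ball P') <= t * Num.sqrt r.
Proof.
move=> r0 t0 rP rP' PP' P'P; rewrite /hausdorff_dist ge_max; apply/andP; split.
- apply: sup_dist_le => [|x]; first by exists 0; exact: unit_ball0.
  exact: unit_ball_approx.
- apply: sup_dist_le => [|x]; first by exists 0; exact: unit_ball0.
  exact: unit_ball_approx.
Qed.

(** The entrywise error costs at most [n%:R * n%:R * d] times the squared length, which coercivity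
    converts into a multiple of [qform P x]. *)
Lemma qform_near P P' (r d : R) x : 0 <= d ->
    (forall y, qform 1%:M y <= r * qform P y) -> `|P' - P| <= d ->
  qform P' x <= (1 + n%:R * n%:R * d * r) * qform P x.
Proof.
move=> d0 rP PP'.
have PP i j : `|(P' - P) i j| <= d by apply: le_trans PP'; exact: mx_norm_entry_le.
have := qform_norm_le x PP.
rewrite /qform bform_addmx -scaleN1r bform_scalemx mulN1r -/(qform P x) => h.
have := le_trans (ler_norm _) h; rewrite -/(qform _ _) => {}h.
rewrite mulrDl mul1r -lerBlDl; apply: (le_trans h).
rewrite -(mulrA _ r) ler_wpM2l ?mulr_ge0 ?ler0n//; exact: rP.
Qed.

(** The same [r] serves [P] and [P'], so [qform_near] applies in both directions with one
    constant. *)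
Lemma hausdorff_dist_near P (r e : R) : 0 <= r -> 0 < e ->
    (forall y, qform 1%:M y <= r * qform P y) ->
  exists2 d : R, 0 < d & forall P',
    (forall y, qform 1%:M y <= r * qform P' y) -> `|P' - P| < d ->
    hausdorff_dist (unit_ball P) (unit_ball P') < e.
Proof.
move=> r0 e0 rP; set c := n%:R * n%:R * r * Num.sqrt r.
have c0 : 0 <= c by rewrite !mulr_ge0 ?ler0n ?sqrtr_ge0.
have d0 : 0 < e / (c + 1) by rewrite divr_gt0// ltr_wpDl.
exists (e / (c + 1)) => // P' rP' /ltW PP'.
set d := e / (c + 1) in d0 PP' *.
apply: (@le_lt_trans _ _ (n%:R * n%:R * d * r * Num.sqrt r)).
  apply: hausdorff_dist_le => //.
  - by apply: mulr_ge0 => //; apply: mulr_ge0; [exact: mulr_ge0|exact: ltW].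
  - by move=> y; apply: qform_near => //; exact: ltW.
  - by move=> y; apply: qform_near => //; [exact: ltW|rewrite distrC].
rewrite (_ : _ * _ = d * c); last by rewrite /c; ring.
by rewrite /d mulrAC ltr_pdivrMr ?ltr_wpDl// ltr_pM2l// ltrDl.
Qed.

End hausdorff_distance.

(** * Second moments of the invariant measure *)

Section ellipsoid_forms.
Variables (R : realType) (n : nat).
Implicit Types (P Q W : 'M[R]_n) (x y z : 'rV[R]_n) (K : set 'rV[R]_n).

Lemma ellipsoid_form (E : ellipsoid R n) :
  exists2 Q, posdef Q & E = unit_ball Q :> set _.
Proof.
have [A uA ->] := ellipsoidP E; exists (invmx A *m (invmx A)^T).
  by apply: gram_posdef; rewrite unitmx_inv.
have qE x : qform (invmx A *m (invmx A)^T) x = qform 1%:M (x *m invmx A).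
  by rewrite qform_mul mulmx1.
apply/seteqP; split => [_ [y /= y1 <-]|x /=].
  by rewrite /unit_ball /= qE mulmxK// -enorm_le1.
rewrite /unit_ball /= qE -enorm_le1 => x1.
by exists (x *m invmx A) => //; rewrite mulmxKV.
Qed.

Lemma form_ellipsoid Q : posdef Q ->
  exists E : ellipsoid R n, E = unit_ball Q :> set _.
Proof.
move=> /cholesky[X uX QX].
suff EP : is_ellipsoid (unit_ball Q) by exists (Ellipsoid EP).
exists (invmx X); first by rewrite unitmx_inv.
have qE x : qform Q x = qform 1%:M (x *m X) by rewrite qform_mul mulmx1 QX.
apply/seteqP; split => [x|_ [y /= y1 <-]] /=; last first.
  by rewrite /unit_ball /= qE mulmxKV// -enorm_le1.
rewrite /unit_ball /= qE -enorm_le1 => x1.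
by exists (x *m X) => //; rewrite mulmxK.
Qed.

Lemma gauge_norm_unit_ball P x : posdef P ->
  gauge_norm (unit_ball P) x = Num.sqrt (qform P x).
Proof.
move=> pP; rewrite /gauge_norm; set A := [set l | _].
have q0 := posdef_ge0 x pP; have s0 := sqrtr_ge0 (qform P x).
have AE l : A l <-> 0 < l /\ Num.sqrt (qform P x) <= l.
  split=> -[l0]; rewrite /unit_ball.
    case=> y /= Py <-; split=> //.
    rewrite qformZ sqrtrM ?sqr_ge0// sqrtr_sqr gtr0_norm// ler_piMr ?(ltW l0)//.
    by rewrite -[leRHS]sqrtr1 ler_wsqrtr.
  move=> xl; split=> //; exists (l^-1 *: x); last first.
    by rewrite scalerA mulfV ?scale1r// gt_eqF.
  rewrite /unit_ball /= qformZ exprVn mulrC ler_pdivrMr ?exprn_gt0// mul1r.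
  by rewrite -(sqr_sqrtr q0) lerXn2r ?nnegrE ?(ltW l0).
apply/eqP; rewrite eq_le; apply/andP; split.
  (* At [x = 0] the infimum is not attained, since the scaling factors are positive; hence the slack
     [e]. *)
  apply/ler_addgt0Pr => e e0; apply: ge_inf.
    by exists 0 => l /AE[/ltW].
  by apply/AE; split; [rewrite ltr_wpDl|rewrite lerDl ltW].
apply: lb_le_inf => [|l /AE[]//].
by exists (Num.sqrt (qform P x) + 1); apply/AE; split;
  [rewrite ltr_wpDl|rewrite lerDl].
Qed.

Lemma nbhs_scale x (A : set 'rV[R]_n) : nbhs x A ->
  exists s : R, [/\ 0 < s, s <= 1, A ((1 - s) *: x) & A ((1 + s) *: x)].
Proof.
rewrite -nbhs_ballE => -[e /= e0 eA].
have xe : 0 < `|x| + e by rewrite ltr_wpDl.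
exists (e / (`|x| + e)).
have s0 : 0 < e / (`|x| + e) by rewrite divr_gt0.
have sx : `|e / (`|x| + e) *: x| < e.
  by rewrite normrZ gtr0_norm// mulrAC ltr_pdivrMr// ltr_pM2l// ltrDl.
split=> //; first by rewrite ler_pdivrMr// mul1r lerDr.
- by apply: eA; rewrite -ball_normE /= scalerBl scale1r subKr.
- apply: eA; rewrite -ball_normE /= scalerDl scale1r opprD addrA subrr add0r.
  by rewrite normrN.
Qed.

Lemma unit_ball_subset K P : is_body K -> posdef P ->
  unit_ball P `<=` K <-> inscribed K P.
Proof.
move=> bK pP; split=> [PK|[_ KP] x Px].
  split=> [|x Kx]; first exact: posdef_sym.
  by apply/ltW; rewrite ltNge; apply/negP => /PK.
(* Membership in [inscribed] leaves open the points outside [K] where the form equals 1. As [K] is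
   closed, such a point can be shrunk a little without entering [K], and there the form is below
   1. *)
apply: contrapT => Kx.
have [] := @nbhs_scale x (~` K).
  by apply: open_nbhs_nbhs; split => //; apply: closed_openC; exact: body_closed.
move=> s [s0 s1 /KP + _]; rewrite qformZ => h.
have h1 : (1 - s) ^+ 2 * qform P x <= (1 - s) ^+ 2.
  by rewrite ler_piMr// sqr_ge0.
nra.
Qed.

Lemma unit_ball_closed Q : closed (unit_ball Q).
Proof.
exact: ((continuous_closedP _).1 (@continuous_qform R n Q)
          [set t | t <= 1] (@closed_le R 1)).
Qed.

Lemma boundary_unit_ball Q : boundary (unit_ball Q) = [set x | qform Q x = 1].
Proof.
rewrite /boundary -(closure_id _).1; last exact: unit_ball_closed.
apply/seteqP; split => [x [Qx /= Qx']|x /= Qx].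
  apply/eqP; rewrite eq_le Qx/= leNgt; apply/negP => Q1; apply: Qx'.
  have oQ : open [set x | qform Q x < 1].
    exact: ((continuousP _).1 (@continuous_qform R n Q)
              [set t | t < 1] (@open_lt R 1)).
  rewrite /interior /=; apply: (filterS (P := [set x | qform Q x < 1])).
    by move=> y /ltW.
  by apply: open_nbhs_nbhs; split.
split=> [|/nbhs_scale[s [s0 s1 _]]]; first by rewrite /unit_ball /= Qx.
by rewrite /unit_ball /= qformZ Qx; nra.
Qed.

(** The proof [pQ] is an argument so that a dot product structure can be attached, as the
    quantification over forms in [is_invariant_measure] demands. *)
Definition dot_of_form Q (pQ : posdef Q) : 'rV[R]_n -> 'rV[R]_n -> R := bform Q.

Lemma dot_of_form_bilinear Q (pQ : posdef Q) :
  bilinear_for *%R (idfun \; *%R) (dot_of_form pQ).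
Proof.
split=> u a x y; rewrite /dot_of_form; first by rewrite bformDl bformZl.
by rewrite bformDr bformZr.
Qed.

HB.instance Definition _ Q (pQ : posdef Q) :=
  bilinear_isBilinear.Build R 'rV[R]_n 'rV[R]_n R *%R (idfun \; *%R)
    (dot_of_form pQ) (dot_of_form_bilinear pQ).

Lemma dot_of_form_sym Q (pQ : posdef Q) x y :
  dot_of_form pQ x y = (-1) ^+ false * idfun (dot_of_form pQ y x).
Proof.
by rewrite expr0 mul1r /= /dot_of_form -{1}(posdef_sym pQ) bform_trmx.
Qed.

HB.instance Definition _ Q (pQ : posdef Q) :=
  isHermitianSesquilinear.Build R 'rV[R]_n false idfun
    (dot_of_form pQ) (dot_of_form_sym pQ).

HB.instance Definition _ Q (pQ : posdef Q) :=
  isDotProduct.Build R 'rV[R]_n (dot_of_form pQ) pQ.2.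

End ellipsoid_forms.

(** * Invariance and integrals over the boundary *)

Section moments.
Variables (R : realType) (n : nat).

Lemma borel_open (A : set 'rV[R]_n) : open A ->
  measurable (A : set (borel_rV R n)).
Proof. exact: sub_sigma_algebra. Qed.

Lemma borel_continuous (f : 'rV[R]_n -> R) (D : set (borel_rV R n)) :
  continuous f -> measurable_fun D (f : borel_rV R n -> R).
Proof.
move=> /continuousP cf; apply: measurable_funTS.
apply: (measurability _ (RGenOpens.measurableE R)).
move=> _ [_ [a [b ->] <-]]; rewrite setTI; apply: borel_open.
exact/cf/interval_open.
Qed.

Lemma borel_mulmx (A : 'M[R]_n) :
  measurable_fun [set: borel_rV R n]
    ((fun x : 'rV[R]_n => x *m A) : borel_rV R n -> borel_rV R n).
Proof.
apply: (@measurability _ _ (borel_rV R n) (borel_rV R n) _ _ (@open 'rV[R]_n)) => //.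
move=> _ [B oB <-]; rewrite setTI; apply: borel_open.
exact: ((continuousP _).1 (@continuous_mulmxr R 1 n A) _ oB).
Qed.

Variables (E : ellipsoid R n) (X : 'M[R]_n).
Hypotheses (uX : X \in unitmx) (EX : E = unit_ball (X *m X^T) :> set _).
Variable m : probability (borel_rV R n) R.
Hypothesis m_inv : is_invariant_measure E m.

Let D : set (borel_rV R n) := boundary (E : set 'rV[R]_n).

Let D_E : D = [set x | qform (X *m X^T) x = 1].
Proof. by rewrite /D EX boundary_unit_ball. Qed.

Let D_closed : closed (D : set 'rV[R]_n).
Proof.
rewrite D_E; exact: ((continuous_closedP _).1 (@continuous_qform R n (X *m X^T))
          [set t | t = 1] (@closed_eq R 1)).
Qed.

Let D_compact : compact (D : set 'rV[R]_n).
Proof.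
have [c c0 cQ] := posdef_coercive (gram_posdef uX).
(* Squared coordinates are at most [c], hence coordinates are at most [c + 1] in absolute value. *)
apply: (@compact_mx R 1 n _ (c + 1)) => // x; rewrite D_E /= => Qx i j.
rewrite ord1; have := coord_sqr_le x j; have := cQ x; rewrite Qx mulr1 => h1 h2.
have h3 := le_trans h2 h1; have : `|x ord0 j| ^+ 2 <= c by rewrite real_normK ?num_real.
have := normr_ge0 (x ord0 j); nra.
Qed.

Let D_measurable : measurable D.
Proof.
by rewrite -[D]setCK; apply: measurableC; apply: borel_open; exact: closed_openC.
Qed.

Let D_integrable (f : 'rV[R]_n -> R) : continuous f ->
  m.-integrable D (EFin \o f).
Proof.
move=> cf; apply: measurable_bounded_integrable => //.
- by apply: (le_lt_trans (probability_le1 m _)) => //; rewrite ltry.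
- exact: borel_continuous.
- have cfD : compact (f @` D).
    by apply: continuous_compact => //; exact: continuous_subspaceT.
  have [M [Mr MfD]] := compact_bounded cfD.
  by exists M; split => // y /MfD h x Dx; apply: h; exists x.
Qed.

Lemma Rintegral_sum_boundary (I : Type) (r : seq I) (f : I -> 'rV[R]_n -> R) :
  (forall i, continuous (f i)) ->
  \int[m]_(x in D) (\sum_(i <- r) f i x) =
  \sum_(i <- r) \int[m]_(x in D) (f i x).
Proof.
move=> cf; have cS s : continuous (fun x => \sum_(i <- s) f i x).
  apply: continuous_big => [|i _]; last exact: cf.
  exact: (@add_continuous R^o).
elim: r => [|i r IH].
  under eq_Rintegral do rewrite big_nil.
  by rewrite big_nil Rintegral_cst// mul0r.
under eq_Rintegral do rewrite big_cons.
by rewrite RintegralD ?IH ?big_cons//; exact: D_integrable.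
Qed.

(** In the coordinates [x *m X] the boundary is the unit sphere. The orthogonal matrix [S] acts
    there as the linear isometry [T], which preserves both [D] and the measure, so the claim is a
    change of variables. *)
Lemma Rintegral_rotation (S : 'M[R]_n) (f : 'rV[R]_n -> R) : continuous f ->
  S *m S^T = 1%:M ->
  \int[m]_(x in D) f (x *m X *m S) = \int[m]_(x in D) f (x *m X).
Proof.
move=> cf SS.
pose T : {linear 'rV[R]_n -> 'rV[R]_n} := mulmxr (X *m S *m invmx X).
have TX x : T x *m X = x *m X *m S by rewrite /= !mulmxA mulmxKV.
have qT x y : bform (X *m X^T) (T x) (T y) = bform (X *m X^T) x y.
  have bE u v : bform (X *m X^T) u v = (u *m X *m (v *m X)^T) ord0 ord0.
    by rewrite /bform trmx_mul !mulmxA.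
  by rewrite !bE !TX trmx_mul -mulmxA (mulmxA S) SS mul1mx.
have pQ := gram_posdef uX.
have mT A : measurable (A : set (borel_rV R n)) -> m (T @^-1` A) = m A.
  apply: (m_inv.2 (dot_of_form pQ)) => [|x y]; last exact: qT.
  by rewrite /scalar_product_of EX.
have measT : measurable_fun [set: borel_rV R n] (T : borel_rV R n -> borel_rV R n).
  exact: borel_mulmx.
have DT : T @^-1` D = D.
  by rewrite D_E; apply/seteqP; split => x /=; rewrite /qform qT.
have cfX : continuous (fun x : 'rV[R]_n => f (x *m X)).
  by move=> x; apply: continuous_comp; [exact: continuous_mulmxr|exact: cf].
have cfT : continuous (fun x : 'rV[R]_n => f (T x *m X)).
  by move=> x; apply: (@continuous_comp _ _ _ T (fun x => f (x *m X)));
    [exact: continuous_mulmxr|exact: cfX].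
rewrite /Rintegral; congr fine.
transitivity (\int[m]_(x in T @^-1` D) ((fun x => (f (x *m X))%:E) \o T) x)%E.
  by rewrite DT; apply: eq_integral => x _ /=; rewrite -TX.
rewrite -(integral_pushforward measT) //.
- apply: eq_measure_integral => A mA _; exact: mT.
- by apply/measurable_EFinP; exact: borel_continuous.
- by rewrite DT; exact: D_integrable.
Qed.

Let g k l (z : 'rV[R]_n) : R := z ord0 k * z ord0 l.

Let g_cont k l : continuous (g k l).
Proof. by apply: continuous_mul; exact: continuous_mxentry. Qed.

Let cont_gX k l : continuous (fun x : 'rV[R]_n => g k l (x *m X)).
Proof.
have cX i : continuous (fun x : 'rV[R]_n => (x *m X) ord0 i).
  under eq_fun do rewrite mxE; apply: continuous_sum => j.
  apply: continuous_mul; [exact: continuous_mxentry|exact: cst_continuous].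
by apply: continuous_mul.
Qed.

Let mom k l := \int[m]_(x in D) g k l (x *m X).

(** The reflection in the [k]-th coordinate changes the sign of the integrand. *)
Lemma moment_offdiag k l : k != l -> mom k l = 0.
Proof.
move=> kl; pose S : 'M[R]_n := diag_mx (\row_j (if j == k then -1 else 1)).
have SS : S *m S^T = 1%:M.
  rewrite tr_diag_mx mulmx_diag; apply/matrixP => i j; rewrite !mxE.
  by case: ifP => _; rewrite ?mulrNN mulr1.
have := Rintegral_rotation (@g_cont k l) SS; rewrite -/(mom k l).
have -> : \int[m]_(x in D) g k l (x *m X *m S) = -1 * mom k l.
  rewrite /mom -RintegralZl//; last by apply: D_integrable; exact: cont_gX.
  apply: eq_Rintegral => x _; rewrite /g /S mul_mx_diag !mxE eqxx.
  by rewrite eq_sym (negbTE kl) mulr1 mulrN1 mulN1r mulNr.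
lra.
Qed.

(** The transposition of the coordinates [k] and [l] is orthogonal. *)
Lemma moment_diag_eq k l : mom k k = mom l l.
Proof.
have SS : tperm_mx k l *m (tperm_mx k l)^T = 1%:M :> 'M[R]_n.
  by rewrite tr_tperm_mx -perm_mxM perm.tperm2 perm_mx1.
rewrite /mom -(Rintegral_rotation (@g_cont k k) SS).
by apply: eq_Rintegral => x _; rewrite /g -xcolE !mxE perm.tpermL.
Qed.

(** The [n] equal diagonal moments add up to the integral of the constant 1 over the boundary, which
    has mass 1. *)
Lemma moment_diag k : mom k k = n%:R^-1.
Proof.
have : \sum_l mom l l = 1.
  rewrite -Rintegral_sum_boundary//.
  under eq_Rintegral => x xD.
    have -> : \sum_l g l l (x *m X) = 1.
      have /set_mem := xD; rewrite D_E /= => <-.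
      rewrite -[X *m X^T]mulmx1 -mulmxA.
      rewrite -[X in qform X x](_ : X *m 1%:M *m X^T = _); last by rewrite mulmx1 mulmx1.
      by rewrite -qform_mul qform1E; apply: eq_bigr => i _; rewrite /g expr2.
    over.
  by rewrite Rintegral_cst// mul1r [X in fine X](_ : _ = 1%E)//; exact: m_inv.1.
under eq_bigr do rewrite (moment_diag_eq _ k).
rewrite sumr_const card_ord => kn.
have nk : n%:R * mom k k = 1 by rewrite mulr_natl.
have n0 : n%:R != 0 :> R.
  by apply/eqP => n0; move: nk; rewrite n0 mul0r => /esym/eqP; rewrite oner_eq0.
by apply: (mulfI n0); rewrite nk mulfV.
Qed.

(** The matrix [N] is [P] in the coordinates [x *m X]. Only its diagonal survives integration, and
    its trace is that of [invmx (X *m X^T) *m P] by cyclicity. *)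
Lemma Rintegral_qform_boundary (P : 'M[R]_n) :
  \int[m]_(x in D) qform P x = n%:R^-1 * \tr (invmx (X *m X^T) *m P).
Proof.
pose N := invmx X *m P *m (invmx X)^T.
have qE x : qform P x = \sum_i \sum_j N i j * g i j (x *m X).
  by rewrite -{1}(mulmxK uX x) qform_mul -/N /qform bformE.
under eq_Rintegral do rewrite qE.
have cN i j : continuous (fun x : 'rV[R]_n => N i j * g i j (x *m X)).
  apply: continuous_mul; [exact: cst_continuous|exact: cont_gX].
rewrite Rintegral_sum_boundary => [|i]; last exact: continuous_sum.
have -> : \tr (invmx (X *m X^T) *m P) = \tr N.
  have uXT : X^T \in unitmx by rewrite unitmx_tr.
  have -> : invmx (X *m X^T) = (invmx X)^T *m invmx X.
    rewrite -[LHS]mulmx1.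
    have <- : X *m X^T *m ((invmx X)^T *m invmx X) = 1%:M.
      by rewrite trmx_inv mulmxA mulmxK// mulmxV.
    by rewrite mulKmx// posdef_unit//; exact: gram_posdef.
  by rewrite -mulmxA mxtrace_mulC /N.
rewrite /mxtrace mulr_sumr; apply: eq_bigr => i _.
rewrite Rintegral_sum_boundary// (bigD1 i)//= big1 ?addr0 => [|j ji].
  rewrite RintegralZl//; last by apply: D_integrable; exact: cont_gX.
  by rewrite -/(mom i i) moment_diag mulrC.
rewrite RintegralZl//; last by apply: D_integrable; exact: cont_gX.
by rewrite -/(mom i j) moment_offdiag ?mulr0// eq_sym.
Qed.

End moments.

(** * Minimal ellipsoids *)

Section minimal_ellipsoids.
Variables (R : realType) (n : nat).
Hypothesis n_gt0 : (0 < n)%N.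
Variable mu : ellipsoid R n -> probability (borel_rV R n) R.
Hypothesis mu_inv : forall E, is_invariant_measure E (mu E).
Implicit Types (E F : ellipsoid R n) (P Q : 'M[R]_n).

Lemma M_forms E F P Q : posdef Q -> E = unit_ball Q :> set _ ->
    posdef P -> F = unit_ball P :> set _ ->
  M_ mu E F = Num.sqrt (n%:R^-1 * \tr (invmx Q *m P)).
Proof.
move=> pQ EQ pP FP; have [X uX QX] := cholesky pQ; rewrite QX in EQ *.
rewrite /M_ -(Rintegral_qform_boundary uX EQ (mu_inv E)).
congr Num.sqrt; apply: eq_Rintegral => x _.
by rewrite FP gauge_norm_unit_ball// sqr_sqrtr// posdef_ge0.
Qed.

Variable K : set 'rV[R]_n.
Hypothesis bK : is_body K.

(** On ellipsoids [M_] is an increasing function of the trace, as [n] is positive, and the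
    ellipsoids contained in [K] correspond to the inscribed forms. *)
Lemma J_minimizer_forms E F P Q : posdef Q -> E = unit_ball Q :> set _ ->
    posdef P -> F = unit_ball P :> set _ ->
  J_minimizer mu K E F <-> minimizes K (invmx Q) P.
Proof.
move=> pQ EQ pP FP; have FK := unit_ball_subset bK pP.
have n0 : 0 < n%:R^-1 :> R by rewrite invr_gt0 ltr0n.
have M_le F' P' : posdef P' -> F' = unit_ball P' :> set _ ->
    (M_ mu E F <= M_ mu E F') = (\tr (invmx Q *m P) <= \tr (invmx Q *m P')).
  move=> pP' FP'; rewrite (M_forms pQ EQ pP FP) (M_forms pQ EQ pP' FP').
  rewrite ler_sqrt ?ler_pM2l// pmulr_rge0// mxtrace_posdef_ge0//.
  exact: posdef_inv.
have lbM : has_lbound [set M_ mu E F | F in [set F : ellipsoid R n | F `<=` K]].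
  by exists 0 => _ [F' _ <-]; exact: sqrtr_ge0.
split=> [[FsubK MJ]|[iP Pmin]].
  split=> [|P' iP']; first by apply/FK; rewrite -FP.
  have pP' := inscribed_posdef bK iP'; have [F' FP'] := form_ellipsoid pP'.
  rewrite -(M_le F')// MJ; apply: ge_inf => //; exists F' => //=.
  by rewrite FP'; exact/unit_ball_subset.
have FsubK : F `<=` K by rewrite FP; exact/FK.
split=> //; apply/eqP; rewrite eq_le; apply/andP; split; last first.
  by apply: ge_inf => //; exists F.
apply: lb_le_inf => [|_ [F' /= F'K <-]]; first by exists (M_ mu E F); exists F.
have [P' pP' FP'] := ellipsoid_form F'.
rewrite (M_le _ P')//; apply: Pmin; apply/unit_ball_subset => //.
by rewrite -FP'.
Qed.

Lemma u_minimizes E Q : posdef Q -> E = unit_ball Q :> set _ ->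
  exists2 P, minimizes K (invmx Q) P & u_ mu K E = unit_ball P :> set _.
Proof.
move=> pQ EQ; have pW := posdef_inv pQ.
have [P0 mP0] := exists_minimizer bK pW.
have pP0 := inscribed_posdef bK mP0.1.
have [F0 FP0] := form_ellipsoid pP0.
have : J_minimizer mu K E (u_ mu K E).
  (* The existence of [F0] ensures that [u_] returns a minimizer rather than the default value
     [E]. *)
  by apply: (@xgetPex _ E [set F | J_minimizer mu K E F]); exists F0;
    exact/(J_minimizer_forms pQ EQ pP0 FP0).
have [P pP uP] := ellipsoid_form (u_ mu K E).
by move=> /(J_minimizer_forms pQ EQ pP uP) mP; exists P.
Qed.

End minimal_ellipsoids.

Theorem mainTheorem2 (R : realType) (n : nat) (n_gt0 : (0 < n)%N)
    (mu : ellipsoid R n -> probability (borel_rV R n) R)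
    (mu_inv : forall E : ellipsoid R n, is_invariant_measure E (mu E))
    (K : set 'rV[R]_n) (K_body : is_body K) :
  hausdorff_continuous (u_ mu K).
Proof.
move=> E eps eps0; have [Q pQ EQ] := ellipsoid_form E.
have [P mP uP] := u_minimizes n_gt0 mu_inv K_body pQ EQ.
have [r r0 Kr] := inscribed_coercive K_body.
(* The tolerances are chosen backwards: [d] for the minimizing matrices, then [t] for the objective
   forms, then [delta] for the ellipsoids. *)
have [d d0 near_d] := hausdorff_dist_near (ltW r0) eps0 (Kr _ mP.1).
have [t t0 stable] := minimizer_stable K_body (posdef_inv pQ) mP d0.
have [delta delta0 polar] := hausdorff_dist_polar pQ t0.
exists delta => // E' EE'; have [Q' pQ' EQ'] := ellipsoid_form E'.
have [P' mP' uP'] := u_minimizes n_gt0 mu_inv K_body pQ' EQ'.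
rewrite EQ EQ' in EE'; have [W'W WW'] := polar _ pQ' EE'.
rewrite uP uP'; apply: near_d; first exact: Kr mP'.1.
exact: stable (posdef_inv pQ') W'W WW' _ mP'.
Qed.
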